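(* Let $d \ge 1$ and $t \geq 2$ be fixed integers, and let $H$ be a fixed $d$-uniform hypergraph with at least two edges such that $\operatorname{ex}_d(n, H) = o(n^{d})$ as $n \to \infty$. Then $$\operatorname{ex}_{d+1}(n, K_{H,t}) = O\left(\operatorname{ex}_d(n, H)^{1/t}\, n^{d+1-d/t} + t\, n^d\right).$$
   Context: All hypergraphs are finite. A $d$-uniform hypergraph is one all of whose edges are $d$-element subsets of the vertex set (for $d=1$ the edges are singletons). A hypergraph is $H$-free if it contains no (not necessarily induced) subhypergraph isomorphic to $H$. For a $d$-uniform hypergraph $H$, $\operatorname{ex}_d(n,H)$ denotes the maximum number of edges in an $H$-free $d$-uniform hypergraph on $n$ vertices. For a $d$-uniform hypergraph $H$ and a positive integer $t$, $K_{H,t}$ is the $(d+1)$-uniform hypergraph obtained from $H$ by adding $t$ new vertices $v_1,\dots,v_t$ and replacing every edge $e \in E(H)$ with the $t$ edges $e\cup\{v_1\},\dots,e\cup\{v_t\}$. (For example, if $H$ is the $1$-uniform hypergraph on $s$ vertices with $s$ edges, then $K_{H,t}=K_{s,t}$.) Asymptotic notation is as $n\to\infty$ with $d$, $t$, $H$ fixed; implied constants may depend on these fixed parameters. *)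

(* Defs.v *)
From mathcomp Require Import all_boot.

Set Implicit Arguments.
Unset Strict Implicit.
Unset Printing Implicit Defensive.

(* A hypergraph on the finite vertex set V is given by its edge set
   G : {set {set V}}; vertices lying in no edge are allowed. *)

Definition uniform (V : finType) (d : nat) (G : {set {set V}}) : bool :=
  [forall e in G, #|e| == d].

(* The copy of H is spanned by the image of f, so the isolated vertices of H
   need distinct images as well. *)
Definition contains_copy (V W : finType) (H : {set {set V}})
    (G : {set {set W}}) : bool :=
  [exists f : {ffun V -> W},
    injectiveb f && [forall e in H, (f @: e) \in G]].

Definition hfree (V W : finType) (H : {set {set V}}) (G : {set {set W}}) :
    bool :=
  ~~ contains_copy H G.

Definition turan (V : finType) (d n : nat) (H : {set {set V}}) : nat :=
  \max_(G : {set {set 'I_n}} | uniform d G && hfree H G) #|G|.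

Definition KHt (V : finType) (H : {set {set V}}) (t : nat) :
    {set {set V + 'I_t}} :=
  [set inr i |: [set inl x | x in e] | e : {set V} in H, i : 'I_t in 'I_t].

(* Main.v *)
Require Import Defs.
From mathcomp Require Import all_boot all_order all_algebra.
From mathcomp Require Import zify lra.
Import Order.TTheory GRing.Theory Num.Theory.

(** The degree [D e] of a [d]-set [e] is the number of vertices [v] such that
    [e] together with [v] is an edge of the [K_{H,t}]-free hypergraph [G].  The
    common link of [t] distinct vertices is [H]-free, so double counting gives
    [sum_e D(e)(D(e)-1)...(D(e)-t+1) <= n^t ex_d(n,H)].  In place of convexity,
    compare each degree with the threshold [lam = ex_d(n,H)^(1/t) n^(1-d/t)]:
    degrees [>= max(2t, lam)] satisfy
    [lam^(t-1) D <= D^t <= 2^t D(D-1)...(D-t+1)], while the other degrees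
    contribute at most [(2t + lam) n^d] in total, and
    [n^d lam^t = n^t ex_d(n,H)] balances the two contributions. *)

Set Implicit Arguments.
Unset Strict Implicit.
Unset Printing Implicit Defensive.

(** The complement of [g @: A :|: B] has at least as many points as the complement of [A], so
    matching the two enumerations index by index extends [g]. *)
Lemma extend_injection (V W : finType) (g : V -> W) (A : {set V}) (B : {set W}) :
  {in A &, injective g} -> {in A, forall x, g x \notin B} ->
  #|V| + #|B| <= #|W| ->
  exists h : V -> W,
    [/\ injective h, {in A, h =1 g} & forall x, h x \notin B].
Proof.
move=> gI gB leVW; pose C := ~: (g @: A :|: B).
have leAC : #|~: A| <= #|C|.
  have := cardsC (g @: A :|: B); have := cardsC A.
  have := cardsU (g @: A) B; rewrite (card_in_imset gI) -/C; lia.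
(* The default [g x] of [nth] is never returned: by [hC] the index is in range whenever [x] lies
   outside [A]. *)
pose h x := if x \in A then g x else nth (g x) (enum C) (index x (enum (~: A))).
have hC x : x \notin A -> index x (enum (~: A)) < size (enum C).
  move=> xA; rewrite -cardE (leq_trans _ leAC)// cardE index_mem mem_enum.
  by rewrite inE.
have hinC x : x \notin A -> h x \in C.
  by move=> xA; rewrite /h (negPf xA) -mem_enum mem_nth ?hC.
have disj x y : x \in A -> y \notin A -> h x <> h y.
  move=> xA yA hxy; have := hinC y yA; rewrite -hxy /h xA !inE negb_or.
  by rewrite imset_f.
exists h; split.
- move=> x y hxy; have [xA|xA] := boolP (x \in A); have [yA|yA] := boolP (y \in A).
  + by move: hxy; rewrite /h xA yA; apply: gI.
  + by case: (disj x y).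
  + by case: (disj y x).
  + move: hxy; rewrite /h (negPf xA) (negPf yA) (set_nth_default (g x)) ?hC//.
    move=> /eqP; rewrite nth_uniq ?hC ?enum_uniq// => /eqP.
    by apply: (index_inj x); rewrite mem_enum inE.
- by move=> x xA; rewrite /h xA.
- move=> x; have [xA|/hinC] := boolP (x \in A); first by rewrite /h xA gB.
  by rewrite !inE negb_or => /andP[].
Qed.

Definition link_vertices (W : finType) (G : {set {set W}}) (e : {set W}) : {set W} :=
  [set v | (v |: e) \in G].

Definition common_link (W : finType) (d t : nat) (G : {set {set W}})
    (f : 'I_t -> W) : {set {set W}} :=
  [set e : {set W} | (#|e| == d) && [forall i, f i \in link_vertices G e]].

Lemma link_vertices_notin (W : finType) (d : nat) (G : {set {set W}}) (e : {set W}) v :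
  uniform d.+1 G -> #|e| = d -> v \in link_vertices G e -> v \notin e.
Proof.
rewrite inE => /forallP/(_ (v |: e))/implyP + ed veG => /(_ veG).
by rewrite cardsU1 ed; case: (v \in e); rewrite // add0n => /eqP; lia.
Qed.

(* A copy of [H] in the common link may send isolated vertices of [H] to some
   [f i]; the bound on [#|W|] leaves room to re-embed them elsewhere. *)
Lemma common_link_hfree (V W : finType) (d t : nat) (H : {set {set V}})
    (G : {set {set W}}) (f : 'I_t -> W) :
  #|V| + t <= #|W| -> uniform d.+1 G -> injective f ->
  hfree (KHt H t) G -> hfree H (common_link d G f).
Proof.
move=> leVW Gu fI; apply: contra => /existsP[g /andP[/injectiveP gI /forallP gH]].
have {gH} gH e : e \in H -> g @: e \in common_link d G f by apply/implyP/gH.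
have [h [hI hg hB]] : exists h : V -> W, [/\ injective h, {in cover H, h =1 g}
    & forall x, h x \notin f @: [set: 'I_t]].
  apply: extend_injection.
  - by move=> x y _ _; apply: gI.
  (* A non-isolated vertex cannot be sent to [f i]: [f i] extends the [d]-set [g @: e] to an edge of
     size [d.+1], so it lies outside that set. *)
  - move=> x /bigcupP[e eH xe]; apply/imsetP => -[i _ gxi].
    have := gH e eH; rewrite inE => /andP[/eqP ed /forallP/(_ i)].
    by move=> /(link_vertices_notin Gu ed); rewrite -gxi imset_f.
  - by rewrite card_imset// cardsT card_ord.
pose k : {ffun V + 'I_t -> W} := [ffun u => match u with inl x => h x | inr i => f i end].
apply/existsP; exists k; apply/andP; split.
  apply/injectiveP => -[x|i] [y|j]; rewrite !ffunE.
  - by move=> /hI ->.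
  - by move=> hxf; have := hB x; rewrite hxf imset_f.
  - by move=> hxf; have := hB y; rewrite -hxf imset_f.
  - by move=> /fI ->.
apply/forallP => E; apply/implyP => /imset2P[e i eH _ ->].
rewrite imsetU1 -imset_comp ffunE.
have -> : [set (k \o inl) x | x in e] = g @: e.
  apply: eq_in_imset => x xe /=; rewrite ffunE hg//.
  by apply/bigcupP; exists e.
by have := gH e eH; rewrite inE => /andP[_ /forallP/(_ i)]; rewrite inE.
Qed.

(** Inserting [v] into [e] maps the pairs in [P] onto a superset of [G], since an edge [E] comes
    from [(E :\ v, v)] for any [v] in [E]. *)
Lemma card_le_sum_link_vertices (W : finType) (d : nat) (G : {set {set W}}) :
  uniform d.+1 G -> #|G| <= \sum_(e : {set W} | #|e| == d) #|link_vertices G e|.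
Proof.
move=> Gu.
pose P := [set p : {set W} * W | (#|p.1| == d) && (p.2 \in link_vertices G p.1)].
have -> : \sum_(e : {set W} | #|e| == d) #|link_vertices G e| = #|P|.
  under eq_bigr do rewrite -sum1_card.
  by rewrite pair_big_dep -sum1_card; apply: eq_bigl => -[e v]; rewrite !inE.
apply: leq_trans (leq_imset_card (fun p => p.2 |: p.1) P).
apply/subset_leq_card/subsetP => E EG.
have /eqP Ed : #|E| == d.+1 by move/forallP: Gu => /(_ E)/implyP; apply.
have /card_gt0P[v vE] : 0 < #|E| by rewrite Ed.
apply/imsetP; exists (E :\ v, v); last by rewrite /= setD1K.
by rewrite !inE /= setD1K// EG andbT; have := cardsD1 v E; rewrite vE Ed; lia.
Qed.

(** The falling factorial counts the injections of ['I_t] into the link of [e]. After exchanging the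
    sums, a fixed injection [f] is counted once for each [e] in its common link, which is
    [H]-free. *)
Lemma sum_ffact_link_vertices (V : finType) (d t n : nat) (H : {set {set V}})
    (G : {set {set 'I_n}}) :
  #|V| + t <= n -> uniform d.+1 G -> hfree (KHt H t) G ->
  \sum_(e : {set 'I_n} | #|e| == d) #|link_vertices G e| ^_ t <= n ^ t * turan d n H.
Proof.
move=> leVn Gu GH.
pose P (e : {set 'I_n}) (f : {ffun 'I_t -> 'I_n}) :=
  (f \in ffun_on (mem (link_vertices G e))) && injectiveb f.
have -> : \sum_(e : {set 'I_n} | #|e| == d) #|link_vertices G e| ^_ t =
    \sum_(e : {set 'I_n} | #|e| == d) \sum_(f | P e f) 1.
  apply: eq_bigr => e _.
  rewrite -[in LHS](card_ord t) -card_inj_ffuns_on sum1_card.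
  by apply: eq_card => f; rewrite !inE.
rewrite (exchange_big_dep (fun f : {ffun 'I_t -> 'I_n} => injectiveb f)) /=; last first.
  by move=> e f _ /andP[].
apply: leq_trans (_ : \sum_(f : {ffun 'I_t -> 'I_n} | injectiveb f) turan d n H <= _).
  apply: leq_sum => f fI; rewrite (eq_bigl (mem (common_link d G f))); last first.
    move=> e; rewrite !inE; congr (_ && _); rewrite /P fI andbT.
    by apply/ffun_onP/forallP.
  rewrite sum1_card; apply: leq_bigmax_cond; apply/andP; split.
    by apply/forallP => e; apply/implyP; rewrite inE => /andP[].
  by apply: common_link_hfree GH; rewrite ?card_ord//; apply/injectiveP.
rewrite sum_nat_const leq_mul2r; apply/orP; right.
by rewrite (leq_trans (max_card _))// card_ffun !card_ord.
Qed.

Lemma expn_le_ffact (t D : nat) : 2 * t <= D -> D ^ t <= 2 ^ t * D ^_ t.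
Proof.
(* The induction runs over the exponent [k] with [t] fixed; each new factor satisfies
   [D <= 2 * (D - k)] because [k < t]. *)
move=> tD; have H k : k <= t -> D ^ k <= 2 ^ k * D ^_ k.
  elim: k => // k IHk kt; rewrite !expnSr ffactnSr mulnACA leq_mul ?IHk//; lia.
exact: H.
Qed.

Lemma card_draws_le (T : finType) (d : nat) :
  #|[pred e : {set T} | #|e| == d]| <= #|T| ^ d.
Proof.
rewrite -cardsE card_draws; move: #|T| => n.
apply: (@leq_trans (n ^_ d)); first by rewrite -bin_ffact leq_pmulr ?fact_gt0.
by elim: d => // d IHd; rewrite ffactnSr expnSr leq_mul ?leq_subr ?IHd.
Qed.

From mathcomp Require Import all_classical all_reals all_analysis.
Import numFieldNormedType.Exports.
Local Open Scope classical_set_scope.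
Local Open Scope ring_scope.

(** With [s.+1] in the role of [t], the three terms on the right cover in turn [D <= 2 * s.+1],
    [D <= lam] and the remaining large [D]. Multiplying by [lam ^+ s] avoids a division by [lam]. *)
Lemma weighted_ffact_bound (R : realFieldType) (s D : nat) (lam : R) : 0 <= lam ->
  lam ^+ s * D%:R <=
    lam ^+ s * (2 * s.+1)%:R + lam ^+ s.+1 + 2 ^+ s.+1 * (D ^_ s.+1)%:R.
Proof.
move=> lam0; have ls0 : 0 <= lam ^+ s by rewrite exprn_ge0.
have f0 : 0 <= 2 ^+ s.+1 * (D ^_ s.+1)%:R :> R by rewrite mulr_ge0 ?exprn_ge0.
have l0 : 0 <= lam ^+ s.+1 by rewrite exprn_ge0.
have a0 : 0 <= lam ^+ s * (2 * s.+1)%:R by rewrite mulr_ge0.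
have [Ds|sD] := leqP D (2 * s.+1).
  rewrite -addrA ler_wpDr ?addr_ge0// ler_wpM2l// ler_nat//.
have [Dl|lD] := lerP D%:R lam.
  by rewrite addrAC ler_wpDl ?addr_ge0// exprSr ler_wpM2l.
rewrite ler_wpDl ?addr_ge0//; apply: (@le_trans _ _ (D%:R ^+ s.+1)).
  by rewrite exprSr ler_wpM2r// lerXn2r ?nnegrE// ltW.
by rewrite -!natrX -natrM ler_nat expn_le_ffact// ltnW.
Qed.

Lemma sum_le_of_sum_ffact (R : realFieldType) (I : finType) (P : pred I)
    (D : I -> nat) (t : nat) (lam M : R) : (0 < t)%N -> 0 <= lam ->
  #|P|%:R <= M -> (\sum_(i | P i) D i ^_ t)%:R <= M * lam ^+ t ->
  (\sum_(i | P i) D i)%:R <= M * ((2 * t)%:R + (1 + 2 ^+ t) * lam).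
Proof.
(* If [lam = 0], the factor [lam ^+ s] may not be cancelled, but then every falling factorial
   vanishes and each [D i] is below [s.+1]. *)
case: t => // s _; rewrite le_eqVlt => /predU1P[<-|lam0] PM SM.
  move: SM; rewrite expr0n/= mulr0 mulr0 addr0 lern0 sum_nat_eq0.
  move=> /forallP SM; apply: (@le_trans _ _ (#|P|%:R * (2 * s.+1)%:R)); last first.
    by rewrite ler_wpM2r.
  rewrite -natrM ler_nat -sum_nat_const leq_sum// => i Pi.
  move/implyP: (SM i) => /(_ Pi); rewrite -leqn0 leqNgt ffact_gt0 -ltnNge; lia.
have ls0 : 0 < lam ^+ s by rewrite exprn_gt0.
rewrite -(ler_pM2l ls0) natr_sum mulr_sumr.
apply: le_trans.
  by apply: ler_sum => i _; apply: weighted_ffact_bound (ltW lam0).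
rewrite big_split/= sumr_const -mulr_sumr -natr_sum -[_ *+ #|_|]mulr_natl.
have : #|P|%:R * (lam ^+ s * (2 * s.+1)%:R + lam ^+ s.+1) <=
  M * (lam ^+ s * (2 * s.+1)%:R + lam ^+ s.+1).
  by rewrite ler_wpM2r// addr_ge0 ?mulr_ge0 ?exprn_ge0 ?(ltW lam0).
have : 2 ^+ s.+1 * (\sum_(i | P i) D i ^_ s.+1)%:R <=
    2 ^+ s.+1 * (M * lam ^+ s.+1) by rewrite ler_wpM2l ?exprn_ge0.
rewrite [lam ^+ s.+1]exprS; set X := _%:R; set Y := _%:R; set Z := _%:R; lra.
Qed.

Theorem theorem2p3 (R : realType) (d t : nat) (V : finType)
    (H : {set {set V}})
    (hd : (1 <= d)%N) (ht : (2 <= t)%N)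
    (Hunif : uniform d H) (Hedges : (2 <= #|H|)%N)
    (Hex : (fun n : nat => (turan d n H)%:R : R) =o_\oo
             (fun n : nat => n%:R ^+ d : R)) :
  (fun n : nat => (turan d.+1 n (KHt H t))%:R : R) =O_\oo
    (fun n : nat =>
       (turan d n H)%:R `^ (1 / t%:R) *
         n%:R `^ (d%:R + 1 - d%:R / t%:R)
       + t%:R * n%:R ^+ d : R).
Proof.
have t0 : (0 < t)%N by apply: leq_trans ht.
have tR : t%:R != 0 :> R by rewrite pnatr_eq0 -lt0n.
(* This constant dominates both coefficients of the final bound [n^d (2 t + (1 + 2^t) lam)]. *)
apply/eqO_exP; exists (2 + 2 ^+ t); first by rewrite addr_gt0 ?exprn_gt0.
near=> n.
have n0 : (0 < n)%N by near: n; exact: nbhs_infty_ge.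
(* Room to re-embed the isolated vertices of [H] away from the [t] added vertices. *)
have Vn : (#|V| + t <= n)%N by near: n; exact: nbhs_infty_ge.
have nR : n%:R != 0 :> R by rewrite pnatr_eq0 -lt0n.
set ex := turan d n H.
pose lam : R := ex%:R `^ (1 / t%:R) * n%:R `^ (1 - d%:R / t%:R).
have lam0 : 0 <= lam by rewrite mulr_ge0 ?powR_ge0.
(* Splitting off [n^d] turns the first term of the target into [n^d lam]. As [1 - d/t] may be
   negative, [n] must be nonzero. *)
have -> : n%:R `^ (d%:R + 1 - d%:R / t%:R) =
    n%:R ^+ d * n%:R `^ (1 - d%:R / t%:R) :> R.
  by rewrite -addrA powRD ?nR ?implybT// powR_mulrn.
rewrite mulrCA -/lam.
have lamt : n%:R ^+ d * lam ^+ t = (n ^ t * ex)%:R.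
  rewrite exprMn -!powR_mulrn ?powR_ge0// -!powRrM mulfVK// powRr1//.
  rewrite mulrBl mul1r mulfVK// mulrCA -powRD ?nR ?implybT//.
  by rewrite addrC subrK powR_mulrn// natrM natrX mulrC.
rewrite ger0_norm// ger0_norm; last by rewrite addr_ge0 ?mulr_ge0.
rewrite /turan; apply: (big_ind (fun m : nat => m%:R <= _)).
- by rewrite mulr_ge0 ?addr_ge0 ?mulr_ge0 ?exprn_ge0.
- by move=> x y xC yC; rewrite /maxn; case: ifP.
move=> G /andP[Gu GH].
apply: (@le_trans _ _ (\sum_(e : {set 'I_n} | #|e| == d) #|link_vertices G e|)%:R).
  by rewrite ler_nat card_le_sum_link_vertices.
apply: (@le_trans _ _ (n%:R ^+ d * ((2 * t)%:R + (1 + 2 ^+ t) * lam))).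
  apply: sum_le_of_sum_ffact => //.
    by rewrite -natrX ler_nat -[X in (_ <= X ^ _)%N]card_ord card_draws_le.
  by rewrite lamt ler_nat sum_ffact_link_vertices.
(* After expansion the right side exceeds the left by [a * lam + c * (b * a)]. *)
rewrite natrM; set a := n%:R ^+ d; set b := t%:R; set c := 2 ^+ t.
have a0 : 0 <= a by rewrite exprn_ge0.
have c0 : 0 <= c by rewrite exprn_ge0.
have al0 : 0 <= a * lam by rewrite mulr_ge0.
have cba0 : 0 <= c * (b * a) by rewrite !mulr_ge0.
lra.
Unshelve. all: by end_near.
Qed.
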